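(* Let $\lambda\in\Lambda[a,b]$ and $1\le p<2$, let $f$ be a $(\lambda,p)$-decomposable function on $[a,b]$, and let $\phi:\mathbb R\to\mathbb R$ be a $C^2$ class function. If $D^+_{\lambda,p}(f)\cup D^-_{\lambda,p}(f)\neq\emptyset$, then the composition $\phi\circ f$ is a $(\lambda,p)$-decomposable function on $[a,b]$.
   Context: Fix real $a<b$. A function $f:[a,b]\to\mathbb R$ is regulated if the finite limits $f(t-)$, $t\in(a,b]$, and $f(s+)$, $s\in[a,b)$, exist; $\Delta^-f(t)=f(t)-f(t-)$ and $\Delta^+f(s)=f(s+)-f(s)$. $\Lambda[a,b]$ is the set of sequences $\lambda=\{\lambda_m:m\ge1\}$ of partitions (finite sets $a=t_0<\dots<t_n=b$) of $[a,b]$ with $\lambda_m\subset\lambda_{m+1}$ and $\cup\lambda:=\bigcup_m\lambda_m$ dense in $[a,b]$. For $a\le s<t\le b$ let $\lambda_m|_{[s,t]}=\{s,t\}\cup(\lambda_m\cap(s,t))=\{s=x_0<\dots<x_n=t\}$. A regulated $f$ has the quadratic $\lambda$-variation on $[a,b]$, written $f\in Q_\lambda[a,b]$, if there is a regulated $V$ on $[a,b]$ with $V(a)=0$ and, for all $a\le s<t\le b$, $V(t)-V(s)=\lim_{m\to\infty}\sum_i[f(x_i)-f(x_{i-1})]^2$ (sum over $\lambda_m|_{[s,t]}$), $\Delta^-V(t)=(\Delta^-f(t))^2$, $\Delta^+V(s)=(\Delta^+f(s))^2$. For $0<p<\infty$, $v_p(f;[a,b])=\sup\sum_i|f(t_i)-f(t_{i-1})|^p$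 over all partitions of $[a,b]$, and $\mathcal W_p[a,b]=\{f:v_p(f;[a,b])<\infty\}$. Let $\mathrm{dual}(\mathcal W_1)[a,b]$ be the set of all regulated functions on $[a,b]$, and for $1<p<\infty$ let $\mathrm{dual}(\mathcal W_p)[a,b]=\bigcup\{\mathcal W_q[a,b]: \tfrac1p+\tfrac1q>1\}$. A regulated $f$ is $(\lambda,p)$-decomposable if there is a pair $(g,h)$ of regulated functions with $g\in Q_\lambda[a,b]\cap\mathrm{dual}(\mathcal W_p)[a,b]$, $h\in\mathcal W_p[a,b]$, $g(a)=h(a)=0$ and $f\equiv C+g+h$ for some constant $C$; $D_{\lambda,p}(f)$ is the set of all such pairs. $D^+_{\lambda,p}(f)$ is the set of $(g,h)\in D_{\lambda,p}(f)$ such that $\{t\in(a,b):\Delta^+g(t)\ne0\}\cup\{t\in(a,b):\Delta^+h(t)\ne0\}\subset\cup\lambda$; $D^-_{\lambda,p}(f)$ is defined in the same way with $\Delta^-$ in place of $\Delta^+$. *)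

(* Defs.v *)
From mathcomp Require Import all_boot all_order all_algebra.
From mathcomp Require Import all_classical all_reals all_analysis.
Import Order.TTheory GRing.Theory Num.Theory numFieldNormedType.Exports.
Set Implicit Arguments.
Unset Strict Implicit.
Unset Printing Implicit Defensive.
Local Open Scope classical_set_scope.
Local Open Scope ring_scope.

(* A function [a, b] -> R is encoded by a total function R -> R. Every notion
   below depends only on its values on [a, b]: the left limits are only taken
   on ]a, b] and the right limits only on [a, b[. *)

Definition regulated (R : realType) (a b : R) : set (R -> R) :=
  [set f | (forall t, a < t <= b -> cvg (f x @[x --> t^'-])) /\
           (forall s, a <= s < b -> cvg (f x @[x --> s^'+]))].

Definition jumpL (R : realType) (f : R -> R) (t : R) : R :=
  f t - lim (f x @[x --> t^'-]).

Definition jumpR (R : realType) (f : R -> R) (s : R) : R :=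
  lim (f x @[x --> s^'+]) - f s.

(* As in itv_partition, a partition a = t_0 < ... < t_n = b is represented by
   the sequence [:: t_1; ...; t_n]; its underlying finite set is a :: s. *)

Definition partition_points (R : realType) (a : R) (s : seq R) : set R :=
  [set x | x \in a :: s].

Definition partition_union (R : realType) (a : R) (lam : nat -> seq R) : set R :=
  \bigcup_m partition_points a (lam m).

(* The sequences are indexed from 0 instead of 1. *)
Definition Lambda (R : realType) (a b : R) : set (nat -> seq R) :=
  [set lam | [/\ forall m, itv_partition a b (lam m),
    forall m, partition_points a (lam m) `<=` partition_points a (lam m.+1) &
    [set x | a <= x <= b] `<=` closure (partition_union a lam)]].

(* For a <= s < t <= b and r a partition of [a, b], the result represents
   {s, t} U (r \cap ]s, t[) as a partition of [s, t]. *)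
Definition partition_restr (R : realType) (r : seq R) (s t : R) : seq R :=
  itv_partitionL (itv_partitionR r s) t.

Definition square_variation (R : realType) (s t : R) (f : R -> R) (r : seq R) : R :=
  let F := f \o nth t (s :: r) in
  \sum_(0 <= i < size r) (F i.+1 - F i) ^+ 2.

Definition Qlam (R : realType) (a b : R) (lam : nat -> seq R) : set (R -> R) :=
  [set f | regulated a b f /\ exists V : R -> R,
    [/\ regulated a b V, V a = 0,
        forall s t, a <= s -> s < t -> t <= b ->
          square_variation s t f (partition_restr (lam m) s t) @[m --> \oo]
            --> V t - V s,
        forall t, a < t <= b -> jumpL V t = jumpL f t ^+ 2 &
        forall s, a <= s < b -> jumpR V s = jumpR f s ^+ 2]].

Definition power_variation (R : realType) (p a b : R) (f : R -> R) (r : seq R) : R :=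
  let F := f \o nth b (a :: r) in
  \sum_(0 <= i < size r) `|F i.+1 - F i| `^ p.

Definition pvariation (R : realType) (p a b : R) (f : R -> R) : \bar R :=
  ereal_sup [set (power_variation p a b f r)%:E | r in itv_partition a b].

Definition Wp (R : realType) (a b p : R) : set (R -> R) :=
  [set f | (pvariation p a b f < +oo)%E].

(* Only meaningful for 1 <= p. *)
Definition dualWp (R : realType) (a b p : R) : set (R -> R) :=
  if p == 1 then regulated a b
  else \bigcup_(q in [set q : R | 0 < q /\ p^-1 + q^-1 > 1]) Wp a b q.

Definition decompositions (R : realType) (a b : R) (lam : nat -> seq R) (p : R)
    (f : R -> R) : set ((R -> R) * (R -> R)) :=
  [set gh | let: (g, h) := gh in
    [/\ regulated a b g /\ regulated a b h,
        (Qlam a b lam `&` dualWp a b p) g,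
        Wp a b p h,
        g a = 0 /\ h a = 0 &
        exists C : R, forall x, a <= x <= b -> f x = C + g x + h x]].

Definition decomposable (R : realType) (a b : R) (lam : nat -> seq R) (p : R)
    (f : R -> R) : Prop :=
  regulated a b f /\ decompositions a b lam p f !=set0.

Definition decompositionsR (R : realType) (a b : R) (lam : nat -> seq R) (p : R)
    (f : R -> R) : set ((R -> R) * (R -> R)) :=
  [set gh | decompositions a b lam p f gh /\
    [set t | a < t < b /\ jumpR gh.1 t != 0] `|`
    [set t | a < t < b /\ jumpR gh.2 t != 0] `<=` partition_union a lam].

Definition decompositionsL (R : realType) (a b : R) (lam : nat -> seq R) (p : R)
    (f : R -> R) : set ((R -> R) * (R -> R)) :=
  [set gh | decompositions a b lam p f gh /\
    [set t | a < t < b /\ jumpL gh.1 t != 0] `|`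
    [set t | a < t < b /\ jumpL gh.2 t != 0] `<=` partition_union a lam].

Definition class_C2 (R : realType) (phi : R -> R) : Prop :=
  [/\ forall x, derivable phi x 1,
      forall x, derivable (derive1 phi) x 1 &
      continuous (derive1 (derive1 phi))].

(* Main.v *)
Require Import Defs.
From mathcomp Require Import all_boot all_order all_algebra.
From mathcomp Require Import all_classical all_reals all_analysis.
From mathcomp Require Import ring lra.
Import Order.TTheory GRing.Theory Num.Theory numFieldNormedType.Exports.
Set Implicit Arguments.
Unset Strict Implicit.
Unset Printing Implicit Defensive.
Local Open Scope classical_set_scope.
Local Open Scope ring_scope.

(** The function [phi \o f] needs no second component: [phi \o f - phi (f a)]
    has a quadratic [lam]-variation and lies in the dual class, so it can be
    paired with the zero function.

    Write [f = C + g + h]. Just to the left of a point [x], [f] stays close to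
    its limit [y], so that the squared increments of [phi \o f] are those of [g]
    multiplied by [phi'(y)^2], with an error that is small with respect to the
    squared increments of [g] and, since [p < 2], to the p-variation of [h]; and
    likewise to the right ([sq_incr_comp], [locally_scaled_comp]). The errors
    are small multiples of the increments of one nondecreasing function, the sum of the
    quadratic variation [V] of [g] and the p-variation of [h].

    In the sums of squares on a small interval that ends at [x], the last term
    converges to a squared jump. The rest is compared with the same sum for [g],
    which converges. Hence the sums for [phi \o f] converge up to a small
    multiple of the increment of that function ([close_left], [close_right]).
    Such estimates can be glued, because the sums are additive in the limit
    ([sqvar_additive]); this requires that off the union of [lam] no jump is
    two-sided, which follows from the condition on the jumps of [g] and [h]. A
    compactness argument ([interval_induction]) then gives them on all
    intervals, and convergence ([sqvar_cvg]). The same local comparison shows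
    that the limit has the right jumps ([bracket_left], [bracket_right]): near
    [x], the increment of [V] minus its jump tends to zero.

    Membership in the dual class is elementary, as [phi] is Lipschitz on the
    range of [f] and [h] itself lies in the dual class when [p < 2]
    ([dualWp_comp]). *)

(** * Sums along chains of points *)

Section chain_sums.
Context {R : realType}.
Implicit Types (w : R -> R -> R) (r s : seq R) (x y t : R).

Fixpoint chain_sum w x s : R :=
  if s is y :: s' then w x y + chain_sum w y s' else 0.

Lemma chain_sum_nth w t x s :
  \sum_(0 <= i < size s) w (nth t (x :: s) i) (nth t (x :: s) i.+1)
  = chain_sum w x s.
Proof.
elim: s x => [|y s ih] x; first by rewrite big_nil.
by rewrite big_nat_recl//= -ih.
Qed.

Lemma chain_sum_cat w x r s :
  chain_sum w x (r ++ s) = chain_sum w x r + chain_sum w (last x r) s.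
Proof. by elim: r x => [|y r ih] x /=; rewrite ?add0r// ih addrA. Qed.

Lemma chain_sum_rcons w x s y :
  chain_sum w x (rcons s y) = chain_sum w x s + w (last x s) y.
Proof. by rewrite -cats1 chain_sum_cat /= addr0. Qed.

Lemma chain_sum_head w x s y : chain_sum w x (rcons s y) =
  w x (head y s) + chain_sum w (head y s) (behead (rcons s y)).
Proof. by case: s => [|z s] /=. Qed.

Lemma chain_sum_ge0 w x s :
  (forall u v, 0 <= w u v) -> 0 <= chain_sum w x s.
Proof. by move=> w0; elim: s x => //= y s ih x; rewrite addr_ge0. Qed.

(** Passing from increments to chains costs nothing, because the part
    [W v - W u] of the error telescopes. This is why the p-variation enters the
    proof through a function [W] rather than through suprema over partitions. *)
Lemma chain_sum_approx (P : R -> Prop) w1 w2 (c e : R) (W : R -> R) x s :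
  (forall u v, P u -> P v -> u < v ->
     `|w1 u v - c * w2 u v| <= e * (w2 u v + (W v - W u))) ->
  path <%R x s -> (forall y, y \in x :: s -> P y) ->
  `|chain_sum w1 x s - c * chain_sum w2 x s| <=
    e * (chain_sum w2 x s + (W (last x s) - W x)).
Proof.
move=> Pw; elim: s x => [|y s ih] x /=.
  by rewrite mulr0 !subr0 normr0 subrr addr0 mulr0.
move=> /andP[xy ys] Ps.
have hy := ih y ys (fun z zs => Ps z (@mem_behead _ (x :: y :: s) _ zs)).
have hx : `|w1 x y - c * w2 x y| <= e * (w2 x y + (W y - W x)).
  by apply: Pw => //; apply: Ps; rewrite !inE eqxx ?orbT.
rewrite [leLHS](_ : _ = `|(w1 x y - c * w2 x y) +
  (chain_sum w1 y s - c * chain_sum w2 y s)|); last by congr `|_|; ring.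
by apply: (le_trans (ler_normD _ _)); apply: (le_trans (lerD hx hy)); lra.
Qed.

End chain_sums.

(** * Square variations along a restricted partition *)

Section squares.
Context {R : realType}.
Implicit Types (f g : R -> R) (r : seq R) (s t u : R).

Definition sq_incr f (u v : R) := (f v - f u) ^+ 2.

Lemma sq_incr_ge0 f u v : 0 <= sq_incr f u v.
Proof. exact: sqr_ge0. Qed.

Definition inner r s t := [seq y <- r | s < y < t].
(** When [r] has no point in ]s, t[, [prev_pt] is [s] and [next_pt] is [t]: in
    all cases they are the neighbours of [t] and of [s] in the restriction of
    [r] to [s, t]. *)
Definition prev_pt r s t := last s (inner r s t).
Definition next_pt r s t := head t (inner r s t).

(** [sqvar f (lam m) s t] is the sum whose limit defines the quadratic
    variation of [f] on [s, t]. *)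
Definition sqvar f r s t := square_variation s t f (partition_restr r s t).

Lemma sqvarE f r s t :
  sqvar f r s t = chain_sum (sq_incr f) s (rcons (inner r s t) t).
Proof.
rewrite /sqvar /square_variation /partition_restr /itv_partitionL /itv_partitionR.
rewrite -filter_predI.
rewrite -(chain_sum_nth _ t); congr (\sum_(0 <= i < size (rcons _ _)) _).
  by apply: eq_filter => y /=; rewrite andbC.
apply/funext => i; rewrite /sq_incr/=.
suff -> : [seq x <- r | [predI < t & > s] x] = inner r s t by [].
by apply: eq_filter => y /=; rewrite andbC.
Qed.

Lemma sqvar_ge0 f r s t : 0 <= sqvar f r s t.
Proof. by rewrite sqvarE; apply: chain_sum_ge0; exact: sq_incr_ge0. Qed.

Lemma inner_path r s t : sorted <%R r -> path <%R s (inner r s t).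
Proof.
move=> sr; rewrite path_sortedE; last exact: lt_trans.
rewrite sorted_filter ?andbT//; last exact: lt_trans.
by apply/allP => y; rewrite mem_filter => /andP[/andP[]].
Qed.

Lemma prev_pt_lt r s t : s < t -> s <= prev_pt r s t < t.
Proof.
move=> st; rewrite /prev_pt.
have : last s (inner r s t) \in s :: inner r s t by exact: mem_last.
rewrite inE => /orP[/eqP ->|]; first by rewrite lexx.
by rewrite mem_filter => /andP[/andP[/ltW -> ->]].
Qed.

Lemma next_pt_gt r s t : s < t -> s < next_pt r s t <= t.
Proof.
move=> st; rewrite /next_pt.
have : head t (inner r s t) \in t :: inner r s t.
  by case: (inner r s t) => [|y q] /=; rewrite !inE ?eqxx ?orbT.
rewrite inE => /orP[/eqP ->|]; first by rewrite lexx andbT.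
by rewrite mem_filter => /andP[/andP[-> /ltW ->]].
Qed.

Lemma prev_pt_ge r s t y : sorted <%R r -> y \in r -> s < y < t ->
  y <= prev_pt r s t.
Proof.
move=> sr yr syt; rewrite /prev_pt.
have : y \in inner r s t by rewrite mem_filter syt.
have := inner_path s t sr.
move: (inner r s t) => l; elim: l s {syt} => //= z q ih s /andP[sz zq].
rewrite inE => /orP[/eqP ->|]; last exact: ih.
have := zq; rewrite path_sortedE; last exact: lt_trans.
move=> /andP[/allP zq' _].
have := mem_last z q; rewrite inE => /orP[/eqP -> //|/zq' /ltW //].
Qed.

Lemma next_pt_le r s t y : sorted <%R r -> y \in r -> s < y < t ->
  next_pt r s t <= y.
Proof.
move=> sr yr syt; rewrite /next_pt.
have : y \in inner r s t by rewrite mem_filter syt.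
have := inner_path s t sr.
case: (inner r s t) => //= z q /andP[_ zq].
rewrite inE => /orP[/eqP -> //|].
have := zq; rewrite path_sortedE; last exact: lt_trans.
by move=> /andP[/allP zq' _] /zq' /ltW.
Qed.

Lemma inner_mem r s t y : y \in s :: inner r s t -> s < t -> s <= y < t.
Proof.
rewrite inE mem_filter => /orP[/eqP-> ->|/andP[/andP[/ltW -> ->]]]//.
by rewrite lexx.
Qed.

Lemma inner_split r s u t : sorted <%R r -> s < u < t ->
  inner r s t = inner r s u ++ (if u \in r then u :: inner r u t else inner r u t).
Proof.
move=> + /andP[su ut]; elim: r => //= y r ih yr.
have sr : sorted <%R r by exact: path_sorted yr.
have yr' : all (> y) r.
  by move: yr; rewrite path_sortedE; [case/andP|exact: lt_trans].
rewrite /inner /= inE -/(inner r s t) -/(inner r s u) -/(inner r u t) ih//.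
have [yu|uy|yu] := ltgtP y u.
- by rewrite (lt_trans yu ut) andbT; case: ifP.
- have -> : inner r s u = [::].
    rewrite /inner -(filter_pred0 r); apply/eq_in_filter => z zr /=.
    move/allP : yr' => /(_ _ zr) /= yz; apply/negbTE.
    by rewrite negb_and -!leNgt (ltW (lt_trans uy yz)) orbT.
  rewrite (lt_trans su uy) andbF/=.
  have -> : u \in r = false.
    by apply/negbTE/negP => /(allP yr') /= /(lt_trans uy); rewrite ltxx.
  by case: ifP.
- subst y; rewrite su ut /=.
  have -> : inner r s u = [::].
    rewrite /inner -(filter_pred0 r); apply/eq_in_filter => z zr /=.
    move/allP : yr' => /(_ _ zr) /= yz; apply/negbTE.
    by rewrite negb_and -!leNgt (ltW yz) orbT.
  have -> // : u \in r = false.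
  by apply/negbTE/negP => /(allP yr') /=; rewrite ltxx.
Qed.

End squares.

(** * Refining partitions *)

Lemma near_left_ex (R : realType) (P : set R) a x : a < x ->
  (\forall u \near x^'-, P u) ->
  exists2 z, a <= z < x & forall u, z < u < x -> P u.
Proof.
move=> ax [e /= e0 eP]; exists (Num.max a (x - e)).
  by rewrite le_max lexx gt_max ax ltrBlDr ltrDl.
move=> y; rewrite gt_max => /andP[/andP[_ xy] yx]; apply: eP => //=.
by rewrite ger0_norm ?subr_ge0 1?ltW//; lra.
Qed.

Lemma near_right_ex (R : realType) (P : set R) b x : x < b ->
  (\forall u \near x^'+, P u) ->
  exists2 z, x < z <= b & forall u, x < u < z -> P u.
Proof.
move=> xb [e /= e0 eP]; exists (Num.min b (x + e)).
  by rewrite lt_min xb ltrDl e0 ge_min lexx.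
move=> y; rewrite lt_min => /andP[xy /andP[_ ye]]; apply: eP => //=.
by rewrite ler0_norm ?subr_le0 1?ltW//; lra.
Qed.

Section mesh.
Context {R : realType}.
Variables (a b : R) (lam : nat -> seq R).
Hypothesis hlam : Lambda a b lam.
Implicit Types (f : R -> R) (s t u x : R).

Lemma Lambda_sorted m : sorted <%R (lam m).
Proof. by have [/(_ m)[/path_sorted]] := hlam. Qed.

Lemma Lambda_mono m n : (m <= n)%N ->
  partition_points a (lam m) `<=` partition_points a (lam n).
Proof.
have [_ sub _] := hlam; move=> /subnK <-; elim: (n - m)%N => // k ih.
exact: subset_trans ih (sub _).
Qed.

Lemma Lambda_mem_near x : a < x -> partition_union a lam x ->
  \forall m \near \oo, x \in lam m.
Proof.
move=> ax [m _ xm]; exists m => // n /= mn.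
have := Lambda_mono mn xm; rewrite /partition_points/= inE => /orP[/eqP xa|//].
by rewrite xa ltxx in ax.
Qed.

Lemma Lambda_dense s t : a <= s -> s < t -> t <= b ->
  exists2 y, s < y < t & \forall m \near \oo, y \in lam m.
Proof.
move=> as_ st tb; have [_ _ /(_ ((s + t) / 2))] := hlam.
have stm : s < (s + t) / 2 < t by apply/andP; split; lra.
have /[swap] /[apply] : a <= (s + t) / 2 <= b by apply/andP; split; lra.
move=> /(_ `]s, t[%classic); case.
  by apply: open_nbhs_nbhs; split; [exact: interval_open|rewrite /= in_itv].
move=> y [ylam]; rewrite /= in_itv/= => yst; exists y => //.
by apply: Lambda_mem_near => //; case/andP: yst => /(le_lt_trans as_).
Qed.

Lemma prev_pt_cvg s t : a <= s -> s < t -> t <= b ->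
  prev_pt (lam m) s t @[m --> \oo] --> t^'-.
Proof.
move=> as_ st tb A tA.
have [z /andP[sz zt] zA] := near_left_ex st tA.
have [y /andP[zy yt] lamy] := Lambda_dense (le_trans as_ sz) zt tb.
rewrite /nbhs/=; near=> m; apply: zA; apply/andP; split.
  apply: (lt_le_trans zy); apply: prev_pt_ge; first exact: Lambda_sorted.
    by near: m.
  by rewrite yt (le_lt_trans sz zy).
by case/andP : (prev_pt_lt (lam m) st).
Unshelve. all: by end_near. Qed.

Lemma next_pt_cvg s t : a <= s -> s < t -> t <= b ->
  next_pt (lam m) s t @[m --> \oo] --> s^'+.
Proof.
move=> as_ st tb A sA.
have [z /andP[sz zt] zA] := near_right_ex st sA.
have [y /andP[sy yz] lamy] := Lambda_dense as_ sz (le_trans zt tb).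
rewrite /nbhs/=; near=> m; apply: zA; apply/andP; split.
  by case/andP : (next_pt_gt (lam m) st).
apply: (le_lt_trans _ yz); apply: next_pt_le; first exact: Lambda_sorted.
  by near: m.
by rewrite sy (lt_le_trans yz zt).
Unshelve. all: by end_near. Qed.

Lemma prev_incr_cvg f s t : regulated a b f -> a <= s -> s < t -> t <= b ->
  f t - f (prev_pt (lam m) s t) @[m --> \oo] --> jumpL f t.
Proof.
move=> [rf _] as_ st tb; apply: cvgB; first exact: cvg_cst.
apply: (@cvg_comp _ _ _ (fun m => prev_pt (lam m) s t) f); last first.
  by apply: rf; rewrite tb (le_lt_trans as_ st).
exact: prev_pt_cvg.
Qed.

Lemma next_incr_cvg f s t : regulated a b f -> a <= s -> s < t -> t <= b ->
  f (next_pt (lam m) s t) - f s @[m --> \oo] --> jumpR f s.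
Proof.
move=> [_ rf] as_ st tb; apply: cvgB; last exact: cvg_cst.
apply: (@cvg_comp _ _ _ (fun m => next_pt (lam m) s t) f); last first.
  by apply: rf; rewrite as_ (lt_le_trans st tb).
exact: next_pt_cvg.
Qed.

(** Removing the point [u] from a chain in which its neighbours are [l] and [n]
    changes the sum of squares by [2 (f u - f l) (f n - f u)]. Once [u] is in
    [lam m] nothing is removed; if it never is, this cross term tends to
    [2 * jumpL f u * jumpR f u]. A two-sided jump that all the partitions
    miss would therefore spoil additivity. *)
Lemma sqvar_additive f s u t : regulated a b f ->
  a <= s -> s < u -> u < t -> t <= b ->
  (~ partition_union a lam u -> jumpL f u * jumpR f u = 0) ->
  sqvar f (lam m) s t - (sqvar f (lam m) s u + sqvar f (lam m) u t)
    @[m --> \oo] --> (0 : R).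
Proof.
move=> rf as_ su ut tb hu.
have sut : s < u < t by rewrite su.
have [lu|nlu] := pselect (partition_union a lam u).
  apply: cvg_near_cst.
  have := Lambda_mem_near (le_lt_trans as_ su) lu.
  apply: filterS => m um; rewrite !sqvarE (inner_split (Lambda_sorted m) sut) um.
  by rewrite rcons_cat -cat_rcons chain_sum_cat last_rcons subrr.
pose e m := 2 * ((f u - f (prev_pt (lam m) s u)) * (f (next_pt (lam m) u t) - f u)).
have : e m @[m --> \oo] --> (2 * (jumpL f u * jumpR f u) : R).
  apply: cvgM; first exact: cvg_cst.
  apply: cvgM; first by apply: prev_incr_cvg => //; lra.
  by apply: next_incr_cvg => //; rewrite (le_trans as_ (ltW su)).
rewrite hu// mulr0; apply: cvg_trans; apply: near_eq_cvg; near=> m.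
rewrite /e !sqvarE (inner_split (Lambda_sorted m) sut) ifF; last first.
  apply/negP => um; apply: nlu; exists m => //.
  by rewrite /partition_points/= inE um orbT.
rewrite rcons_cat chain_sum_cat [in X in _ = _ - (_ + X)]chain_sum_head.
rewrite [in X in _ = X - _]chain_sum_head chain_sum_rcons.
by rewrite -/(next_pt _ _ _) -/(prev_pt _ _ _) /sq_incr; ring.
Unshelve. all: by end_near. Qed.

End mesh.

(** * Functions whose squared increments are locally proportional *)

Section interval_induction.
Context {R : realType}.

(** A compactness argument: the supremum of the [x] such that [P s x] holds is
    reached from the left and can be passed to the right. *)
Lemma interval_induction (a b : R) (P : R -> R -> Prop) :
  (forall s u t, a <= s -> s < u -> u < t -> t <= b -> P s u -> P u t -> P s t) ->
  (forall x, a < x <= b -> \forall u \near x^'-, P u x) ->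
  (forall x, a <= x < b -> \forall u \near x^'+, P x u) ->
  forall s t, a <= s -> s < t -> t <= b -> P s t.
Proof.
move=> Padd PL PR s t as_ st tb.
pose E := [set x | s < x <= t /\ P s x].
have step x : s <= x -> x < t -> (s = x \/ P s x) -> exists2 y, x < y & E y.
  move=> sx xt sPx; have : \forall y \near x^'+, [/\ x < y, y <= t & P x y].
    near=> y; split; near: y; [exact: nbhs_right_gt|exact: nbhs_right_le|].
    by apply: PR; lra.
  move=> /filter_ex[y [xy yt Pxy]]; exists y => //; split; first by lra.
  have [->//|sx'] := eqVneq s x.
  have {}sx : s < x by rewrite lt_neqAle sx'.
  by case: sPx => [->//|Psx]; apply: (Padd s x y) => //; lra.
have [y0 _ Ey0] := step s (lexx _) st (or_introl erefl).
have supE : has_sup E by split; [exists y0|exists t => x [/andP[]]].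
have leT x : E x -> x <= sup E by move=> Ex; apply: ub_le_sup => //; exact: supE.2.
have sT : s < sup E.
  by case: (Ey0) => /andP[sy0 _] _; exact: lt_le_trans sy0 (leT _ Ey0).
have Tt : sup E <= t by apply: ge_sup; [exact: supE.1|move=> x [/andP[]]].
have PT : P s (sup E).
  have : \forall u \near (sup E)^'-, [/\ s < u, u < sup E & P u (sup E)].
    near=> u; split; near: u; [exact: nbhs_left_gt|exact: nbhs_left_lt|].
    by apply: PL; lra.
  move=> [d /= d0 hd].
  have [u Eu uT] := sup_adherent d0 supE.
  have uleT : u <= sup E by exact: leT.
  have [->|uneT] := eqVneq (sup E) u; first by case: Eu.
  have utT : u < sup E by rewrite lt_neqAle eq_sym uneT.
  have [|//|su _ Puy] := hd u.
    by rewrite /= ger0_norm; lra.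
  by apply: (Padd s u) => //; [exact: le_trans tb|case: Eu].
have [tT|Tt'] := leP t (sup E).
  by have -> : t = sup E by apply/eqP; rewrite eq_le tT Tt.
have [y yT Ey] := step _ (ltW sT) Tt' (or_intror PT).
by have := leT _ Ey; rewrite leNgt yT.
Unshelve. all: by end_near. Qed.

End interval_induction.

Section scaled.
Context {R : realType}.
Variables (a b : R) (lam : nat -> seq R).
Hypothesis hlam : Lambda a b lam.

Definition increments_close (F g W : R -> R) (c e : R) (I : R -> Prop) :=
  forall u v, I u -> I v -> u < v ->
    `|sq_incr F u v - c * sq_incr g u v| <= e * (sq_incr g u v + (W v - W u)).

(** Next to each point and on each side of it, the squared increments of [F] are
    a multiple of those of [g], up to a small error. The point itself is
    excluded, so that jumps are invisible here; the factor depends on the point,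
    on the side and on the precision. For [F] a function of [g] the factor is
    the square of the derivative at the one-sided limit. *)
Definition locally_scaled (F g W : R -> R) :=
  (forall e x, 0 < e -> a < x <= b -> exists2 c, 0 <= c & exists2 z, a <= z < x &
     increments_close F g W c e (fun u => z < u < x)) /\
  (forall e x, 0 < e -> a <= x < b -> exists2 c, 0 <= c & exists2 z, x < z <= b &
     increments_close F g W c e (fun u => x < u < z)).

(** [EF] and [Eg] stand for the one term of a square variation that involves the
    endpoint where a jump may occur. It converges to the squared jump, and only
    the rest is compared between [F] and [g]. *)
Lemma interior_limit (SF Sg EF Eg : nat -> R) (c e D v jF jg : R) :
  (forall m, `|(SF m - EF m) - c * (Sg m - Eg m)| <= e * (Sg m - Eg m + D)) ->
  EF m @[m --> \oo] --> jF -> Eg m @[m --> \oo] --> jg -> Sg m @[m --> \oo] --> v ->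
  forall eta, 0 < eta -> \forall m \near \oo,
    `|SF m - (c * (v - jg) + jF)| <= e * (v - jg + D) + eta.
Proof.
move=> close cEF cEg cSg eta eta0.
pose r m := e * (Sg m - Eg m + D) + `|c * (Sg m - Eg m - (v - jg))| + `|EF m - jF|.
have cr : r m @[m --> \oo] -->
    e * (v - jg + D) + `|c * (v - jg - (v - jg))| + `|jF - jF|.
  apply: cvgD.
    apply: cvgD.
      apply: cvgM; first exact: cvg_cst.
      by apply: cvgD; [exact: cvgB|exact: cvg_cst].
    apply: cvg_norm; apply: cvgM; first exact: cvg_cst.
    by apply: cvgB; [exact: cvgB|exact: cvg_cst].
  by apply: cvg_norm; apply: cvgB => //; exact: cvg_cst.
rewrite !subrr mulr0 normr0 !addr0 in cr.
near=> m; apply: (@le_trans _ _ (r m)); last first.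
  by near: m; apply: (cvgr_le _ cr); rewrite ltrDl.
rewrite /r [X in `|X|](_ : _ = (SF m - EF m - c * (Sg m - Eg m)) +
  c * (Sg m - Eg m - (v - jg)) + (EF m - jF)); last by ring.
apply: (le_trans (ler_normD _ _)); rewrite lerD2r.
by apply: (le_trans (ler_normD _ _)); rewrite lerD2r.
Unshelve. all: by end_near. Qed.

Section existence.
Variables (F g V W : R -> R).
Hypothesis rF : regulated a b F.
Hypothesis rg : regulated a b g.
Hypothesis ndW : forall u v, a <= u -> u <= v -> v <= b -> W u <= W v.
Hypothesis VE : forall s t, a <= s -> s < t -> t <= b ->
  sqvar g (lam m) s t @[m --> \oo] --> V t - V s.

Lemma V_le s t : a <= s -> s < t -> t <= b -> V s <= V t.
Proof.
move=> as_ st tb; rewrite -subr_ge0; have h := VE as_ st tb.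
rewrite -(cvg_lim _ h)//; apply: limr_ge; first by apply/cvg_ex; eexists; exact: h.
by apply: nearW => m; exact: sqvar_ge0.
Qed.

(** On an interval that ends at [x], the limit points of the square variation of
    [F] are confined near the value that exact proportionality away from [x]
    would give. *)
Lemma close_left c e z x u : 0 < e -> a <= z -> z < u -> u < x -> x <= b ->
  increments_close F g W c e (fun y => z < y < x) ->
  forall eta, 0 < eta -> \forall m \near \oo,
    `|sqvar F (lam m) u x - (c * (V x - V u - jumpL g x ^+ 2) + jumpL F x ^+ 2)| <=
    e * (V x - V u - jumpL g x ^+ 2 + (W x - W u)) + eta.
Proof.
move=> e0 az zu ux xb close.
have au : a <= u by lra.
apply: (@interior_limit _ (fun m => sqvar g (lam m) u x)
  (fun m => sq_incr F (prev_pt (lam m) u x) x)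
  (fun m => sq_incr g (prev_pt (lam m) u x) x)).
- move=> m; rewrite !sqvarE !chain_sum_rcons -!/(prev_pt _ _ _) !addrK.
  have [+ +] := andP (prev_pt_lt (lam m) ux) => uL Lx.
  apply: le_trans (chain_sum_approx close _ _) _.
  + exact/inner_path/(Lambda_sorted hlam).
  + by move=> y /inner_mem -/(_ ux)/andP[uy ->]; rewrite (lt_le_trans zu uy).
  + rewrite ler_pM2l// lerD2l lerD2r; apply: ndW => //; first exact: le_trans uL.
    exact: ltW.
- by apply: cvgM; exact: prev_incr_cvg rF au ux xb.
- by apply: cvgM; exact: prev_incr_cvg rg au ux xb.
- exact: VE.
Qed.

Lemma close_right c e z x u : 0 < e -> a <= x -> x < u -> u < z -> z <= b ->
  increments_close F g W c e (fun y => x < y < z) ->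
  forall eta, 0 < eta -> \forall m \near \oo,
    `|sqvar F (lam m) x u - (c * (V u - V x - jumpR g x ^+ 2) + jumpR F x ^+ 2)| <=
    e * (V u - V x - jumpR g x ^+ 2 + (W u - W x)) + eta.
Proof.
move=> e0 ax xu uz zb close.
have ub : u <= b by lra.
apply: (@interior_limit _ (fun m => sqvar g (lam m) x u)
  (fun m => sq_incr F x (next_pt (lam m) x u))
  (fun m => sq_incr g x (next_pt (lam m) x u))).
- move=> m; rewrite !sqvarE !(chain_sum_head _ x) -!/(next_pt _ _ _).
  rewrite ![_ + chain_sum _ _ _]addrC !addrK.
  have /andP[xN Nu] := next_pt_gt (lam m) xu.
  have Nmem y : y \in next_pt (lam m) x u :: behead (rcons (inner (lam m) x u) u) ->
      x < y <= u.
    have -> : next_pt (lam m) x u :: behead (rcons (inner (lam m) x u) u) =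
      rcons (inner (lam m) x u) u by rewrite /next_pt; case: (inner _ _ _).
    rewrite mem_rcons inE => /orP[/eqP ->|]; first by rewrite xu lexx.
    by rewrite mem_filter => /andP[/andP[-> /ltW ->]].
  apply: le_trans (chain_sum_approx close _ _) _.
  + have := inner_path x u (Lambda_sorted hlam m).
    have : all (< u) (inner (lam m) x u).
      by apply/allP => y; rewrite mem_filter => /andP[/andP[]].
    rewrite /next_pt; case: (inner _ _ _) => //= y q /andP[yu qu] /andP[_ yq].
    rewrite rcons_path yq/=.
    by have := mem_last y q; rewrite inE => /orP[/eqP ->//|/(allP qu)].
  + by move=> y /Nmem/andP[-> yu]; exact: le_lt_trans uz.
  + rewrite ler_pM2l// lerD2l.
    have -> : last (next_pt (lam m) x u) (behead (rcons (inner (lam m) x u) u)) = u.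
      by rewrite /next_pt; case: (inner _ _ _) => //= y q; rewrite last_rcons.
    by rewrite lerD2l lerN2; apply: ndW => //; [exact: ltW|exact: le_trans ub].
- by apply: cvgM; exact: next_incr_cvg rF ax xu ub.
- by apply: cvgM; exact: next_incr_cvg rg ax xu ub.
- exact: VE.
Qed.

Hypothesis FgW : locally_scaled F g W.
Hypothesis jF : forall u, a < u < b -> ~ partition_union a lam u ->
  jumpL F u * jumpR F u = 0.

Let U x := V x + W x.

(** The error is the increment of a function, so that the property is additive
    over adjacent intervals and needs to be checked only next to each point. *)
Let approx_limit e s t := exists L, forall eta, 0 < eta -> \forall m \near \oo,
  `|sqvar F (lam m) s t - L| <= e * (U t - U s) + eta.

Lemma approx_limit_all e s t : 0 < e -> a <= s -> s < t -> t <= b ->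
  approx_limit e s t.
Proof.
move=> e0; apply: interval_induction s t.
- move=> s u t as_ su ut tb [L1 h1] [L2 h2]; exists (L1 + L2) => eta eta0.
  have eta3 : 0 < eta / 3 by rewrite divr_gt0.
  have := sqvar_additive hlam rF as_ su ut tb (jF _).
  have /[swap] /[apply] : a < u < b by lra.
  move=> /cvgrPdist_le /(_ _ eta3) h3.
  near=> m.
  have k1 : `|sqvar F (lam m) s u - L1| <= e * (U u - U s) + eta / 3.
    by near: m; exact: h1.
  have k2 : `|sqvar F (lam m) u t - L2| <= e * (U t - U u) + eta / 3.
    by near: m; exact: h2.
  have : `|0 - (sqvar F (lam m) s t - (sqvar F (lam m) s u + sqvar F (lam m) u t))|
    <= eta / 3 by near: m; exact: h3.
  rewrite sub0r normrN => k3.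
  rewrite [X in `|X|](_ : _ =
    (sqvar F (lam m) s t - (sqvar F (lam m) s u + sqvar F (lam m) u t)) +
    (sqvar F (lam m) s u - L1) + (sqvar F (lam m) u t - L2)); last by ring.
  apply: (le_trans (ler_normD _ _)).
  apply: (le_trans (lerD (ler_normD _ _) (lexx _))).
  lra.
- move=> x axb; have [c c0 [z /andP[az zx] close]] := FgW.1 e x e0 axb.
  near=> u; exists (c * (V x - V u - jumpL g x ^+ 2) + jumpL F x ^+ 2) => eta eta0.
  have zu : z < u by near: u; exact: nbhs_left_gt.
  have ux : u < x by near: u; exact: nbhs_left_lt.
  have xb : x <= b by case/andP: axb.
  apply: filterS (close_left e0 az zu ux xb close eta0) => m /le_trans; apply.
  rewrite lerD2r ler_pM2l// /U; have := sqr_ge0 (jumpL g x); lra.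
- move=> x axb; have [c c0 [z /andP[xz zb] close]] := FgW.2 e x e0 axb.
  near=> u; exists (c * (V u - V x - jumpR g x ^+ 2) + jumpR F x ^+ 2) => eta eta0.
  have uz : u < z by near: u; exact: nbhs_right_lt.
  have xu : x < u by near: u; exact: nbhs_right_gt.
  have ax : a <= x by case/andP: axb.
  apply: filterS (close_right e0 ax xu uz zb close eta0) => m /le_trans; apply.
  rewrite lerD2r ler_pM2l// /U; have := sqr_ge0 (jumpR g x); lra.
Unshelve. all: by end_near. Qed.

Lemma sqvar_cvg s t : a <= s -> s < t -> t <= b ->
  cvg (sqvar F (lam m) s t @[m --> \oo]).
Proof.
move=> as_ st tb; apply: cauchy_cvg; apply: cauchy_exP => e e0.
have U0 : 0 <= U t - U s.
  by have := V_le as_ st tb; have := ndW as_ (ltW st) tb; rewrite /U; lra.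
pose d := e / 2 / (U t - U s + 1).
have d0 : 0 < d by rewrite !divr_gt0//; lra.
have [L hL] := approx_limit_all d0 as_ st tb; exists L.
have e4 : 0 < e / 4 by rewrite divr_gt0.
rewrite /nbhs/=; apply: filterS (hL _ e4) => m hm.
rewrite /ball/= distrC; apply: (le_lt_trans hm).
suff : d * (U t - U s) <= e / 2 by lra.
rewrite /d mulrAC ler_pdivrMr; last by lra.
by rewrite ler_pM2l ?divr_gt0//; lra.
Qed.

Lemma dist_le_lim (u : nat -> R) (l L K : R) : u m @[m --> \oo] --> l ->
  (forall eta, 0 < eta -> \forall m \near \oo, `|u m - L| <= K + eta) ->
  `|l - L| <= K.
Proof.
move=> ul hu; apply/ler_addgt0Pr => eta eta0.
have cu : `|u m - L| @[m --> \oo] --> `|l - L|.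
  by apply: cvg_norm; apply: cvgB => //; exact: cvg_cst.
rewrite -(cvg_lim _ cu)//; apply: limr_le; last exact: hu.
by apply/cvg_ex; eexists; exact: cu.
Qed.

Definition bracket x :=
  if x <= a then 0 else lim (sqvar F (lam m) a x @[m --> \oo]).

Lemma bracketE s t : a <= s -> s < t -> t <= b ->
  sqvar F (lam m) s t @[m --> \oo] --> bracket t - bracket s.
Proof.
move=> as_ st tb; have sb := ltW (lt_le_trans st tb).
rewrite /bracket leNgt (le_lt_trans as_ st)/=.
case: (leP s a) => sa.
  have -> : s = a by apply/eqP; rewrite eq_le sa.
  by rewrite subr0; apply: sqvar_cvg => //; exact: le_lt_trans st.
have cs := sqvar_cvg (lexx a) sa sb.
have ct := sqvar_cvg (lexx a) (lt_trans sa st) tb.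
have j : ~ partition_union a lam s -> jumpL F s * jumpR F s = 0.
  by apply: jF; rewrite sa (lt_le_trans st tb).
have h0 := sqvar_additive hlam rF (lexx a) sa st tb j.
have -> : (fun m => sqvar F (lam m) s t) = (fun m =>
    sqvar F (lam m) a t - sqvar F (lam m) a s -
    (sqvar F (lam m) a t - (sqvar F (lam m) a s + sqvar F (lam m) s t))).
  by apply/funext => m; ring.
rewrite -[X in _ --> X]subr0; apply: cvgB h0; exact: cvgB.
Qed.

Hypothesis rV : regulated a b V.
Hypothesis jVL : forall x, a < x <= b -> jumpL V x = jumpL g x ^+ 2.
Hypothesis jVR : forall x, a <= x < b -> jumpR V x = jumpR g x ^+ 2.

(** Here [x] is an increment of [bracket], [v] the increment of [V] minus its
    jump, [w] an increment of [W] and [J] the expected jump of [bracket]. As the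
    increment shrinks to the jump, [v] tends to [0] while [w] may not; what [w]
    contributes is a multiple of the precision [d] only. *)
Lemma increment_sub_jump_le (c d v w w0 J x : R) : 0 <= c -> 0 <= d -> w <= w0 ->
  (c + d) * `|v| <= d -> `|x - (c * v + J)| <= d * (v + w) ->
  `|x - J| <= d * (w0 + 1).
Proof.
move=> c0 d0 ww vd hx.
rewrite [X in `|X|](_ : _ = (x - (c * v + J)) + c * v); last by ring.
apply: (le_trans (ler_normD _ _)); apply: (le_trans (lerD hx (lexx _))).
rewrite normrM (ger0_norm c0).
have h1 : d * w <= d * w0 by rewrite ler_wpM2l.
have h2 : d * v <= d * `|v| by rewrite ler_wpM2l// ler_norm.
by move: vd; rewrite mulrDl; lra.
Qed.

Lemma bracket_left x : a < x <= b ->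
  bracket u @[u --> x^'-] --> bracket x - jumpL F x ^+ 2.
Proof.
move=> axb; have [ax xb] := andP axb; apply/cvgrPdist_le => e e0.
have W0 : 0 <= W b - W a by rewrite subr_ge0; apply: ndW => //; lra.
pose d := e / (W b - W a + 1).
have d0 : 0 < d by rewrite divr_gt0//; lra.
have [c c0 [z /andP[az zx] close]] := FgW.1 d x d0 axb.
have cd0 : 0 < c + d by lra.
have cV : V u @[u --> x^'-] --> V x - jumpL g x ^+ 2.
  rewrite -(jVL axb) /jumpL opprB addrCA subrr addr0.
  exact: rV.1.
move/cvgrPdist_le : cV => /(_ _ (divr_gt0 d0 cd0)) cV.
near=> u.
have zu : z < u by near: u; exact: nbhs_left_gt.
have ux : u < x by near: u; exact: nbhs_left_lt.
have au := ltW (le_lt_trans az zu).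
have := dist_le_lim (bracketE au ux xb) (close_left d0 az zu ux xb close).
move=> h.
have -> : e = d * (W b - W a + 1) by rewrite /d divfK//; lra.
rewrite [X in `|X|](_ : _ = bracket x - bracket u - jumpL F x ^+ 2); last by ring.
apply: (increment_sub_jump_le c0 (ltW d0) _ _ h).
  by apply: lerB; apply: ndW => //; lra.
rewrite mulrC -ler_pdivlMr//.
rewrite [X in `|X|](_ : _ = V x - jumpL g x ^+ 2 - V u); last by ring.
by near: u.
Unshelve. all: by end_near. Qed.

Lemma bracket_right x : a <= x < b ->
  bracket u @[u --> x^'+] --> bracket x + jumpR F x ^+ 2.
Proof.
move=> axb; have [ax xb] := andP axb; apply/cvgrPdist_le => e e0.
have W0 : 0 <= W b - W a by rewrite subr_ge0; apply: ndW => //; lra.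
pose d := e / (W b - W a + 1).
have d0 : 0 < d by rewrite divr_gt0//; lra.
have [c c0 [z /andP[xz zb] close]] := FgW.2 d x d0 axb.
have cd0 : 0 < c + d by lra.
have cV : V u @[u --> x^'+] --> V x + jumpR g x ^+ 2.
  rewrite -(jVR axb) /jumpR addrCA subrr addr0.
  exact: rV.2.
move/cvgrPdist_le : cV => /(_ _ (divr_gt0 d0 cd0)) cV.
near=> u.
have uz : u < z by near: u; exact: nbhs_right_lt.
have xu : x < u by near: u; exact: nbhs_right_gt.
have ub := ltW (lt_le_trans uz zb).
have := dist_le_lim (bracketE ax xu ub) (close_right d0 ax xu uz zb close).
move=> h.
have -> : e = d * (W b - W a + 1) by rewrite /d divfK//; lra.
rewrite -normrN [X in `|X|](_ : _ = bracket u - bracket x - jumpR F x ^+ 2);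
  last by ring.
apply: (increment_sub_jump_le c0 (ltW d0) _ _ h).
  by apply: lerB; apply: ndW => //; lra.
rewrite mulrC -ler_pdivlMr//.
rewrite -normrN [X in `|X|](_ : _ = V x + jumpR g x ^+ 2 - V u); last by ring.
by near: u.
Unshelve. all: by end_near. Qed.

End existence.

Lemma Qlam_locally_scaled F g W : Qlam a b lam g -> regulated a b F ->
  (forall u v, a <= u -> u <= v -> v <= b -> W u <= W v) ->
  locally_scaled F g W ->
  (forall u, a < u < b -> ~ partition_union a lam u ->
    jumpL F u * jumpR F u = 0) ->
  Qlam a b lam F.
Proof.
move=> [rg [V [rV V0 VE jVL jVR]]] rF ndW FgW jF; split=> //.
have left_ := bracket_left rF rg ndW VE FgW jF rV jVL.
have right_ := bracket_right rF rg ndW VE FgW jF rV jVR.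
exists (bracket F); split.
- split=> x axb; apply/cvg_ex; eexists; [exact: left_|exact: right_].
- by rewrite /bracket lexx.
- exact: bracketE rF rg ndW VE FgW jF.
- by move=> x axb; rewrite /jumpL (cvg_lim _ (left_ x axb))//; rewrite /jumpL; ring.
- by move=> x axb; rewrite /jumpR (cvg_lim _ (right_ x axb))//; rewrite /jumpR; ring.
Qed.

End scaled.

(** * Functions of bounded p-variation *)

Section control.
Context {R : realType}.
Implicit Types (f g h W : R -> R) (p q u v x : R).

(** Bounded p-variation in additive form: the p-variation of [f] on [a, x], as a
    function of [x], is such a [W] if it is finite. *)
Definition p_control a b p f W := forall u v, a <= u -> u <= v -> v <= b ->
  `|f v - f u| `^ p <= W v - W u.

Lemma p_control_nd a b p f W u v : p_control a b p f W ->
  a <= u -> u <= v -> v <= b -> W u <= W v.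
Proof.
by move=> fW au uv vb; rewrite -subr_ge0 (le_trans (powR_ge0 _ _) (fW _ _ au uv vb)).
Qed.

Lemma power_variationE p a b f r : power_variation p a b f r =
  chain_sum (fun u v => `|f v - f u| `^ p) a r.
Proof. by rewrite -(chain_sum_nth _ b). Qed.

Lemma pvariation_step p a f u v : u <= v -> p != 0 ->
  (pvariation p a u f + (`|f v - f u| `^ p)%:E <= pvariation p a v f)%E.
Proof.
move=> uv p0; have [->|uv'] := eqVneq u v.
  by rewrite subrr normr0 powR0// adde0.
have {uv'}uv : u < v by rewrite lt_neqAle uv'.
rewrite -leeBrDr//; apply: ge_ereal_sup => _ [r [ar /eqP ru] <-].
rewrite leeBrDr// -EFinD; apply: ereal_sup_ubound; exists (rcons r v).
  by split; [rewrite rcons_path ar ru|rewrite last_rcons].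
by rewrite !power_variationE chain_sum_rcons ru.
Qed.

Lemma pvariation_ge0 p a x f : a <= x -> p != 0 -> (0 <= pvariation p a x f)%E.
Proof.
move=> ax p0; apply: le_trans (pvariation_step a f ax p0).
rewrite adde_ge0 ?lee_fin ?powR_ge0//; apply: ereal_sup_ubound.
by exists [::]; [split|rewrite power_variationE].
Qed.

Lemma Wp_control a b p f : p != 0 -> Wp a b p f ->
  exists W, p_control a b p f W.
Proof.
move=> p0 fp; exists (fun x => fine (pvariation p a x f)) => u v au uv vb.
have fin x : a <= x -> x <= b -> pvariation p a x f \is a fin_num.
  move=> ax xb; rewrite ge0_fin_numE ?pvariation_ge0//; apply: le_lt_trans fp.
  apply: le_trans (pvariation_step a f xb p0).
  by rewrite leeDl// lee_fin powR_ge0.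
rewrite lerBrDl -lee_fin EFinD !fineK ?fin ?pvariation_step//.
- exact: le_trans uv.
- exact: le_trans vb.
Qed.

Lemma chain_sum_control a b p f W x r : p_control a b p f W ->
  path <%R x r -> a <= x -> last x r <= b ->
  chain_sum (fun u v => `|f v - f u| `^ p) x r <= W (last x r) - W x.
Proof.
move=> fW; elim: r x => [|y r ih] x /=; first by rewrite subrr.
move=> /andP[xy yr] ax lb; have ay := le_trans ax (ltW xy).
have yl : y <= last y r by apply: (@itv_partition_le _ _ _ _ r); split.
have h := fW _ _ ax (ltW xy) (le_trans yl lb).
by have := ih y yr ay lb; lra.
Qed.

Lemma control_Wp a b p f W : p_control a b p f W -> Wp a b p f.
Proof.
move=> fW; apply: (@le_lt_trans _ _ (W b - W a)%:E); last exact: ltry.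
apply: ge_ereal_sup => _ [r [ar /eqP rb] <-]; rewrite lee_fin power_variationE.
by have := chain_sum_control fW ar (lexx a); rewrite rb; apply.
Qed.

Lemma p_control_lip a b p f g W (K : R) : 0 < p -> 0 <= K ->
  (forall u v, a <= u -> u <= v -> v <= b -> `|g v - g u| <= K * `|f v - f u|) ->
  p_control a b p f W -> p_control a b p g (fun x => K `^ p * W x).
Proof.
move=> p0 K0 gf fW u v au uv vb; rewrite -mulrBr.
apply: (@le_trans _ _ (K `^ p * `|f v - f u| `^ p)).
  rewrite -powRM//; apply: ge0_ler_powR; rewrite ?nnegrE ?mulr_ge0//.
    exact: ltW.
  exact: gf.
by rewrite ler_wpM2l ?powR_ge0//; exact: fW.
Qed.

Lemma p_control_add a b p f g h W1 W2 : 0 < p ->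
  (forall u v, a <= u -> u <= v -> v <= b ->
     f v - f u = (g v - g u) + (h v - h u)) ->
  p_control a b p g W1 -> p_control a b p h W2 ->
  p_control a b p f (fun x => 2 `^ p * (W1 x + W2 x)).
Proof.
move=> p0 fgh gW hW u v au uv vb; rewrite fgh// -mulrBr.
set x := g v - g u; set y := h v - h u; pose m := Num.max `|x| `|y|.
have m0 : 0 <= m by rewrite le_max normr_ge0.
apply: (@le_trans _ _ (2 `^ p * m `^ p)).
  rewrite -powRM//; apply: ge0_ler_powR; rewrite ?nnegrE ?mulr_ge0//.
    exact: ltW.
  apply: (le_trans (ler_normD _ _)).
  have xm : `|x| <= m by rewrite le_max lexx.
  have ym : `|y| <= m by rewrite le_max lexx orbT.
  lra.
rewrite ler_wpM2l ?powR_ge0//.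
have hg := gW u v au uv vb; have hh := hW u v au uv vb.
have := powR_ge0 `|x| p; have := powR_ge0 `|y| p.
rewrite -/x -/y in hg hh.
by rewrite /m; case: (leP `|x| `|y|) => _; lra.
Qed.

Lemma p_control_bounded a b p f W : 0 < p -> p_control a b p f W ->
  exists2 B, 0 <= B & forall u v, a <= u -> u <= v -> v <= b -> `|f v - f u| <= B.
Proof.
move=> p0 fW; exists ((W b - W a) `^ p^-1); first exact: powR_ge0.
move=> u v au uv vb.
have pV : 0 <= p^-1 by rewrite invr_ge0 ltW.
have Wuv : W v - W u <= W b - W a.
  by apply: lerB; apply: (p_control_nd fW) => //; lra.
have /(ge0_ler_powR pV) := le_trans (fW u v au uv vb) Wuv.
rewrite -powRrM divff ?gt_eqF// powRr1//; apply; rewrite nnegrE ?powR_ge0//.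
by apply: le_trans Wuv; apply: le_trans (fW u v au uv vb); exact: powR_ge0.
Qed.

Lemma p_control_exponent a b p q f W : 0 < p -> p <= q -> p_control a b p f W ->
  exists W', p_control a b q f W'.
Proof.
move=> p0 pq fW; have [B B0 fB] := p_control_bounded p0 fW.
exists (fun x => B `^ (q - p) * W x) => u v au uv vb; rewrite -mulrBr.
set d := `|_|.
have -> : d `^ q = d `^ (q - p) * d `^ p.
  have [->|d0] := eqVneq d 0.
    by rewrite (@powR0 _ q) ?(@powR0 _ p) ?mulr0 ?gt_eqF// (lt_le_trans p0).
  by rewrite -powRD ?d0 ?implybT// subrK.
apply: ler_pM; rewrite ?powR_ge0//; last exact: fW.
by apply: ge0_ler_powR; rewrite ?subr_ge0 ?nnegrE ?normr_ge0//; exact: fB.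
Qed.

(** The reason why [h] contributes only its jumps to the quadratic variation:
    where its oscillation is small, its squared increments are negligible with
    respect to its p-variation. *)
Lemma sqr_le_powR p (e : R) : p < 2 -> 0 < e ->
  exists2 d, 0 < d & forall x, `|x| < d -> x ^+ 2 <= e * `|x| `^ p.
Proof.
move=> p2 e0; have q0 : 0 < 2 - p by rewrite subr_gt0.
exists (e `^ (2 - p)^-1) => [|x xd]; first exact: powR_gt0.
have [->|x0] := eqVneq x 0.
  by rewrite expr0n/= mulr_ge0// ?ltW// powR_ge0.
rewrite -real_normK ?num_real// -powR_mulrn// -(subrK p 2%:R).
rewrite powRD ?normr_eq0 ?x0 ?implybT// ler_wpM2r ?powR_ge0//.
have /(ge0_ler_powR (ltW q0)) := ltW xd.
rewrite -powRrM mulVf ?gt_eqF// (powRr1 (ltW e0)); apply; rewrite nnegrE//.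
exact: powR_ge0.
Qed.

End control.

(** * Composition with a continuously differentiable function *)

Section composition.
Context {R : realType}.

Variable phi : R -> R.
Hypothesis dphi : forall x, derivable phi x 1.
Hypothesis cphi : continuous (derive1 phi).

Lemma MVT_ball x y c d : `|x - c| < d -> `|y - c| < d ->
  exists2 z, `|z - c| < d & phi y - phi x = derive1 phi z * (y - x).
Proof.
wlog xy : x y / x < y => [th xd yd|].
  have [xy|yx|->] := ltgtP x y; first exact: th.
    have [z zd e] := th y x yx yd xd; exists z => //.
    by rewrite -opprB e -mulrN opprB.
  by exists y => //; rewrite !subrr mulr0.
rewrite !ltr_distl => /andP[x1 x2] /andP[y1 y2].
have der z : z \in `]x, y[ -> is_derive z 1 phi (derive1 phi z).
  by move=> _; rewrite derive1E; exact/derivableP.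
have cont : {within `[x, y], continuous phi}.
  exact: derivable_within_continuous.
have [z + e] := MVT xy der cont; rewrite in_itv/= => /andP[xz zy].
by exists z => //; rewrite ltr_distl; apply/andP; split; lra.
Qed.

Lemma continuous_C1 : continuous phi.
Proof.
by move=> x; apply: differentiable_continuous; exact/derivable1_diffP.
Qed.

Lemma Lipschitz_C1 (c B : R) : 0 <= B ->
  exists2 K, 0 <= K & forall x y, `|x - c| <= B -> `|y - c| <= B ->
    `|phi y - phi x| <= K * `|y - x|.
Proof.
move=> B0; have B1 : c - (B + 1) <= c + (B + 1) by lra.
have cn : {within `[c - (B + 1), c + (B + 1)],
    continuous (fun x => `|derive1 phi x|)}.
  apply: continuous_subspaceT => x.
  by apply: continuous_comp; [exact: cphi|exact: norm_continuous].
have [z _ zmax] := EVT_max B1 cn.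
exists `|derive1 phi z| => // x y xB yB.
have [||w wB ->] := @MVT_ball x y c (B + 1); [lra|lra|].
rewrite normrM ler_wpM2r//; apply: zmax; rewrite in_itv/=.
by move: wB; rewrite ltr_distl => /andP[/ltW -> /ltW ->].
Qed.

(** By the mean value theorem the increment of [phi] is [(k + q) * (G + D)] with
    [k] the derivative at [y] and [q] small. In its square the cross term is
    absorbed as [2 |G D| <= eta G^2 + D^2 / eta]; choosing [eta] first, and then
    [D] small, makes everything but [k^2 G^2] negligible with respect to [G^2]
    and [|D|^p]. *)
Lemma sq_incr_comp p (y e : R) : p < 2 -> 0 < e ->
  exists2 c, 0 <= c & exists2 d, 0 < d & forall x1 x2 G D,
    `|x1 - y| < d -> `|x2 - y| < d -> x2 - x1 = G + D -> `|D| < d ->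
    `|(phi x2 - phi x1) ^+ 2 - c * G ^+ 2| <= e * (G ^+ 2 + `|D| `^ p).
Proof.
move=> p2 e0; pose k : R := derive1 phi y; exists (k ^+ 2); first exact: sqr_ge0.
pose K := `|k| + 1.
have K0 : 0 < K by rewrite /K; have := normr_ge0 k; lra.
pose del := Num.min 1 (e / 4 / K).
have del0 : 0 < del by rewrite lt_min ltr01 !divr_gt0.
have del1 : del <= 1 by rewrite ge_min lexx.
have delK : del * K <= e / 4.
  by rewrite -ler_pdivlMr// ge_min lexx orbT.
pose eta := e / 2 / K ^+ 2.
have eta0 : 0 < eta by rewrite !divr_gt0// exprn_gt0.
pose th := e / (K ^+ 2 * (eta^-1 + 1)).
have M0 : 0 < K ^+ 2 * (eta^-1 + 1).
  by rewrite mulr_gt0 ?exprn_gt0// addr_gt0// invr_gt0.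
have th0 : 0 < th by rewrite divr_gt0.
have [d1 d10 hd1] := sqr_le_powR p2 th0.
have cy : derive1 phi x @[x --> y] --> derive1 phi y by exact: cphi.
move/cvgrPdist_lt : cy => /(_ _ del0)/nbhs_ballP[d2 /= d20 hd2].
exists (Num.min d1 d2); first by rewrite lt_min d10.
move=> x1 x2 G D; rewrite !lt_min => /andP[_ x1d] /andP[_ x2d] xGD /andP[Dd _].
have [z zd ->] := MVT_ball x1d x2d; rewrite xGD.
have /ltW : `|derive1 phi y - derive1 phi z| < del.
  by apply: hd2; rewrite /ball/= distrC.
rewrite distrC -/k; set q := derive1 phi z - k => hq.
have -> : derive1 phi z = k + q by rewrite /q; ring.
have kq : `|k + q| <= K by apply: (le_trans (ler_normD _ _)); rewrite /K; lra.
have {}Dd := hd1 _ Dd.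
have kq2 : (k + q) ^+ 2 <= K ^+ 2.
  by rewrite -[(k + q) ^+ 2]real_normK ?num_real// ler_sqr ?nnegrE// ltW.
have P0 : 0 <= `|D| `^ p := powR_ge0 _ _.
have b1 : `|(q * (k + q + k)) * G ^+ 2| <= e / 2 * G ^+ 2.
  rewrite normrM (ger0_norm (sqr_ge0 G)) ler_wpM2r ?sqr_ge0// normrM.
  apply: (@le_trans _ _ (del * (2 * K))); last by lra.
  apply: ler_pM => //; apply: (le_trans (ler_normD _ _)); rewrite /K in kq *; lra.
have b2 : `|2 * G * D + D ^+ 2| <= eta * G ^+ 2 + (eta^-1 + 1) * D ^+ 2.
  have e1 : eta * eta^-1 = 1 by rewrite divff ?gt_eqF.
  have s1 : 0 <= eta * (G + eta^-1 * D) ^+ 2 by rewrite mulr_ge0 ?sqr_ge0// ltW.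
  have s2 : 0 <= eta * (G - eta^-1 * D) ^+ 2 by rewrite mulr_ge0 ?sqr_ge0// ltW.
  have E1 : eta * (G + eta^-1 * D) ^+ 2 = eta * G ^+ 2 + 2 * G * D + eta^-1 * D ^+ 2.
    transitivity (eta * G ^+ 2 + 2 * (eta * eta^-1) * G * D +
      (eta * eta^-1) * eta^-1 * D ^+ 2); first by ring.
    by rewrite e1; ring.
  have E2 : eta * (G - eta^-1 * D) ^+ 2 = eta * G ^+ 2 - 2 * G * D + eta^-1 * D ^+ 2.
    transitivity (eta * G ^+ 2 - 2 * (eta * eta^-1) * G * D +
      (eta * eta^-1) * eta^-1 * D ^+ 2); first by ring.
    by rewrite e1; ring.
  have D0 := sqr_ge0 D.
  by rewrite ler_norml; apply/andP; split; lra.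
rewrite [X in `|X|](_ : _ = q * (k + q + k) * G ^+ 2 +
  (k + q) ^+ 2 * (2 * G * D + D ^+ 2)); last by ring.
apply: (le_trans (ler_normD _ _)).
have b3 : `|(k + q) ^+ 2 * (2 * G * D + D ^+ 2)| <= e / 2 * G ^+ 2 + e * `|D| `^ p.
  rewrite normrM (ger0_norm (sqr_ge0 (k + q))).
  apply: (@le_trans _ _ (K ^+ 2 * (eta * G ^+ 2 + (eta^-1 + 1) * D ^+ 2))).
    by apply: ler_pM => //; exact: sqr_ge0.
  rewrite mulrDr; apply: lerD.
    by rewrite mulrA /eta (mulrC (K ^+ 2)) divfK// gt_eqF ?exprn_gt0.
  rewrite mulrA; apply: (@le_trans _ _ (K ^+ 2 * (eta^-1 + 1) * (th * `|D| `^ p))).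
    by rewrite ler_pM2l.
  by rewrite mulrA /th (mulrC (K ^+ 2 * _)) divfK// gt_eqF.
lra.
Qed.

Section scaled_comp.
Variables (a b C k p : R) (f g h W : R -> R).
Hypothesis p2 : p < 2.
Hypothesis fE : forall x, a <= x <= b -> f x = C + g x + h x.
Hypothesis hW : p_control a b p h W.

Lemma increments_close_comp y c d e l (I : R -> Prop) : 0 < e ->
  (forall x1 x2 G D,
    `|x1 - y| < d -> `|x2 - y| < d -> x2 - x1 = G + D -> `|D| < d ->
    `|(phi x2 - phi x1) ^+ 2 - c * G ^+ 2| <= e * (G ^+ 2 + `|D| `^ p)) ->
  (forall u, I u -> a <= u <= b /\ `|f u - y| < d /\ `|h u - l| < d / 2) ->
  increments_close (fun x => phi (f x) - k) g W c e I.
Proof.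
move=> e0 H hI u v /hI[/andP[au ub] [fu hu]] /hI[/andP[av vb] [fv hv]] uv.
rewrite /sq_incr [X in X ^+ 2 - _](_ : _ = phi (f v) - phi (f u)); last by ring.
apply: le_trans (H _ _ (g v - g u) (h v - h u) fu fv _ _) _.
- by rewrite !fE ?au ?av//; ring.
- move: hu hv; rewrite !ltr_norml => /andP[? ?] /andP[? ?].
  by apply/andP; split; lra.
- by rewrite ler_pM2l// lerD2l hW// ltW.
Qed.

Lemma locally_scaled_comp : regulated a b f -> regulated a b h ->
  locally_scaled a b (fun x => phi (f x) - k) g W.
Proof.
move=> rf rh; split=> e x e0 axb; have [ax xb] := andP axb.
- have [c c0 [d d0 H]] := sq_incr_comp (lim (f u @[u --> x^'-])) p2 e0.
  exists c => //.
  have d20 : 0 < d / 2 by rewrite divr_gt0.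
  have /cvgrPdist_lt/(_ _ d0) nf := rf.1 x axb.
  have /cvgrPdist_lt/(_ _ d20) nh := rh.1 x axb.
  have [z azx hz] := near_left_ex ax (filterI nf nh); exists z => //.
  apply: increments_close_comp e0 H _ => u /[dup] zux /hz[].
  rewrite distrC => fu; rewrite distrC => hu; split; last by split; [|exact: hu].
  by apply/andP; split; lra.
- have [c c0 [d d0 H]] := sq_incr_comp (lim (f u @[u --> x^'+])) p2 e0.
  exists c => //.
  have d20 : 0 < d / 2 by rewrite divr_gt0.
  have /cvgrPdist_lt/(_ _ d0) nf := rf.2 x axb.
  have /cvgrPdist_lt/(_ _ d20) nh := rh.2 x axb.
  have [z azx hz] := near_right_ex xb (filterI nf nh); exists z => //.
  apply: increments_close_comp e0 H _ => u /[dup] zux /hz[].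
  rewrite distrC => fu; rewrite distrC => hu; split; last by split; [|exact: hu].
  by apply/andP; split; lra.
Qed.

End scaled_comp.

Lemma regulated_comp a b k f : regulated a b f ->
  regulated a b (fun x => phi (f x) - k).
Proof.
move=> [fL fR]; split=> x axb; apply: is_cvgB; try exact: is_cvg_cst.
- apply/cvg_ex; exists (phi (lim (f u @[u --> x^'-]))).
  by apply: continuous_cvg; [exact: continuous_C1|exact: fL].
- apply/cvg_ex; exists (phi (lim (f u @[u --> x^'+]))).
  by apply: continuous_cvg; [exact: continuous_C1|exact: fR].
Qed.

Lemma jumpL_comp a b k f x : regulated a b f -> a < x <= b ->
  jumpL f x = 0 -> jumpL (fun x => phi (f x) - k) x = 0.
Proof.
move=> [rf _] axb /eqP; rewrite /jumpL subr_eq0 => /eqP fx.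
have h : phi (f u) - k @[u --> x^'-] --> phi (f x) - k.
  apply: cvgB; last exact: cvg_cst.
  by apply: continuous_cvg; [exact: continuous_C1|rewrite fx; exact: rf].
by rewrite (cvg_lim _ h)// subrr.
Qed.

Lemma jumpR_comp a b k f x : regulated a b f -> a <= x < b ->
  jumpR f x = 0 -> jumpR (fun x => phi (f x) - k) x = 0.
Proof.
move=> [_ rf] axb /eqP; rewrite /jumpR subr_eq0 => /eqP fx.
have h : phi (f u) - k @[u --> x^'+] --> phi (f x) - k.
  apply: cvgB; last exact: cvg_cst.
  by apply: continuous_cvg; [exact: continuous_C1|rewrite -fx; exact: rf].
by rewrite (cvg_lim _ h)// subrr.
Qed.

Lemma p_control_comp a b k p f W : 0 < p -> p_control a b p f W ->
  exists W', p_control a b p (fun x => phi (f x) - k) W'.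
Proof.
move=> p0 fW; have [B B0 fB] := p_control_bounded p0 fW.
have [K K0 phiK] := Lipschitz_C1 (f a) B0.
eexists; apply: p_control_lip p0 K0 _ fW => u v au uv vb.
rewrite [X in `|X|](_ : _ = phi (f v) - phi (f u)); last by ring.
by apply: phiK; apply: fB => //; [exact: le_trans uv vb|exact: le_trans au uv].
Qed.

End composition.

(** * Jumps and dual class of a decomposed function *)

Section decomposition.
Context {R : realType}.
Variables (a b C : R) (f g h : R -> R).
Hypothesis fE : forall x, a <= x <= b -> f x = C + g x + h x.
Hypotheses (rg : regulated a b g) (rh : regulated a b h).

Lemma jumpLD x : a < x <= b -> jumpL f x = jumpL g x + jumpL h x.
Proof.
move=> axb; have [ax xb] := andP axb; rewrite /jumpL.
have F : f u @[u --> x^'-] -->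
    C + lim (g u @[u --> x^'-]) + lim (h u @[u --> x^'-]).
  apply: (@cvg_trans _ ((C + g u + h u) @[u --> x^'-])).
    apply: near_eq_cvg; near=> u; rewrite fE//; apply/andP; split.
      by near: u; exact: nbhs_left_ge.
    by apply: le_trans xb; near: u; exact: nbhs_left_le.
  by apply: cvgD; [apply: cvgD; [exact: cvg_cst|exact: rg.1]|exact: rh.1].
by rewrite (cvg_lim _ F)// fE ?(ltW ax)//; ring.
Unshelve. all: by end_near. Qed.

Lemma jumpRD x : a <= x < b -> jumpR f x = jumpR g x + jumpR h x.
Proof.
move=> axb; have [ax xb] := andP axb; rewrite /jumpR.
have F : f u @[u --> x^'+] -->
    C + lim (g u @[u --> x^'+]) + lim (h u @[u --> x^'+]).
  apply: (@cvg_trans _ ((C + g u + h u) @[u --> x^'+])).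
    apply: near_eq_cvg; near=> u; rewrite fE//; apply/andP; split.
      by apply: (le_trans ax); near: u; exact: nbhs_right_ge.
    by near: u; exact: nbhs_right_le.
  by apply: cvgD; [apply: cvgD; [exact: cvg_cst|exact: rg.2]|exact: rh.2].
by rewrite (cvg_lim _ F)// fE ?ax ?(ltW xb)//; ring.
Unshelve. all: by end_near. Qed.

(** [h] belongs to the dual class as well, since [p < 2] gives [2 / p > 1]; so
    the larger of [p] and the exponent of [g] serves for their sum. *)
Lemma dualWp_comp (phi : R -> R) p k : (forall x, derivable phi x 1) ->
  continuous (derive1 phi) -> regulated a b f ->
  1 <= p < 2 -> dualWp a b p g -> Wp a b p h ->
  dualWp a b p (fun x => phi (f x) - k).
Proof.
move=> dphi cphi rf /andP[p1 p2]; rewrite /dualWp; case: ifPn => [_ _ _|np1].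
  exact: regulated_comp.
have p0 : 0 < p by lra.
move=> [q /= [q0 pq] /(Wp_control (lt0r_neq0 q0))[Wg gW]].
move=> /(Wp_control (lt0r_neq0 p0))[Wh hW].
have [r [pr qr pr1]] : exists r, [/\ p <= r, q <= r & 1 < p^-1 + r^-1].
  have [pq'|qp] := leP p q; first by exists q.
  exists p; split => //; first exact: ltW.
  have : 2^-1 < p^-1 by rewrite ltf_pV2 ?posrE.
  lra.
have r0 : 0 < r by lra.
have [Wg' gW'] := p_control_exponent q0 qr gW.
have [Wh' hW'] := p_control_exponent p0 pr hW.
exists r => //.
have fW := @p_control_add _ a b r f g h _ _ r0 _ gW' hW'.
have [|W FW] := p_control_comp dphi cphi k r0 (fW _).
  move=> u v au uv vb; rewrite !fE; first by ring.
    by rewrite au (le_trans uv).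
  by rewrite vb (le_trans au).
exact: control_Wp FW.
Qed.

End decomposition.

Theorem theorem3 (R : realType) (a b : R) (hab : a < b)
    (lam : nat -> seq R) (hlam : Lambda a b lam)
    (p : R) (hp : 1 <= p < 2)
    (f : R -> R) (hf : decomposable a b lam p f)
    (phi : R -> R) (hphi : class_C2 phi)
    (hD : decompositionsR a b lam p f `|` decompositionsL a b lam p f !=set0) :
  decomposable a b lam p (phi \o f).
Proof.
have [rf _] := hf; have [dphi d2phi _] := hphi.
have cphi : continuous (derive1 phi).
  by move=> x; apply: differentiable_continuous; exact/derivable1_diffP.
have [p1 p2] := andP hp; have p0 : 0 < p by lra.
set F := fun x => phi (f x) - phi (f a).
have rF : regulated a b F by exact: regulated_comp.
(* Off the union of [lam], the jumps of [g] and [h], hence those of [f], all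
   vanish on one side, the same for all points. *)
have [g [h [gh jump]]] : exists g h, decompositions a b lam p f (g, h) /\
    forall u, a < u < b -> ~ partition_union a lam u -> jumpL f u * jumpR f u = 0.
  case: hD => -[g h] [] [gh sub]; exists g, h; split=> //;
      have [[rg rh] _ _ _ [C fE]] := gh => u aub nu.
    have axb : a <= u < b by lra.
    rewrite (jumpRD fE rg rh axb).
    have -> : jumpR g u = 0 by apply: contra_notP nu => /eqP g0; apply: sub; left.
    have -> : jumpR h u = 0 by apply: contra_notP nu => /eqP g0; apply: sub; right.
    by rewrite addr0 mulr0.
  have axb : a < u <= b by lra.
  rewrite (jumpLD fE rg rh axb).
  have -> : jumpL g u = 0 by apply: contra_notP nu => /eqP g0; apply: sub; left.
  have -> : jumpL h u = 0 by apply: contra_notP nu => /eqP g0; apply: sub; right.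
  by rewrite addr0 mul0r.
have [[rg rh] [Qg dg] hWp _ [C fE]] := gh.
have [W hW] := Wp_control (lt0r_neq0 p0) hWp.
have QF : Qlam a b lam F.
  apply: (Qlam_locally_scaled hlam (g := g) (W := W)) => //.
  - by move=> u v; exact: p_control_nd hW.
  - exact: (locally_scaled_comp dphi cphi _ p2 fE hW rf rh).
  - move=> u aub nu; have /eqP := jump u aub nu; rewrite mulf_eq0 => /orP[]/eqP j.
      by rewrite /F (jumpL_comp dphi _ rf _ j) ?mul0r//; lra.
    by rewrite /F (jumpR_comp dphi _ rf _ j) ?mulr0//; lra.
split.
  have := @regulated_comp _ phi dphi a b 0 f rf.
  by rewrite (_ : (fun x => _) = phi \o f)//; apply/funext => x; rewrite subr0.
exists (F, cst 0); split.
- split=> //; split=> x _; exact: is_cvg_cst.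
- split=> //; exact: (dualWp_comp fE).
- apply: (@control_Wp _ _ _ _ _ (cst 0)) => u v _ _ _.
  by rewrite /= subrr normr0 powR0 ?gt_eqF.
- by rewrite /F subrr.
- by exists (phi (f a)) => x _; rewrite /F /=; ring.
Qed.
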